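(* Let $M,N\ge1$ be integers, $P,\sigma^2,\beta_1,\beta_2>0$, and $\alpha_{\rm NCR}\ge0$. Define $$\mathrm{SNR}_{\rm NCR}=\frac{\alpha_{\rm NCR}^2PM\beta_1\beta_2}{\sigma^2(1+\alpha_{\rm NCR}^2\beta_2M)},\qquad \mathrm{SNR}_{\rm P\text{-}RIS}=\frac{P\beta_1\beta_2N^2M}{\sigma^2}.$$ If $1-N^2M\beta_2>0$, then $$\mathrm{SNR}_{\rm NCR}\ge\mathrm{SNR}_{\rm P\text{-}RIS}\iff \alpha_{\rm NCR}\ge\frac{N}{\sqrt{1-N^2M\beta_2}}.$$ If $N^2M\beta_2\ge1$, then $\mathrm{SNR}_{\rm P\text{-}RIS}>\mathrm{SNR}_{\rm NCR}$ for every $\alpha_{\rm NCR}\ge0$.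
   Context: $\mathrm{SNR}_{\rm NCR}$ and $\mathrm{SNR}_{\rm P\text{-}RIS}$ are the maximal uplink signal-to-noise ratios (no direct user–base-station link) with, respectively, a network-controlled repeater of amplification gain $\alpha_{\rm NCR}$ and a passive RIS with $N$ elements; $M$ is the number of base station antennas. *)

(* Defs.v *)
From HB Require Import structures.
From mathcomp Require Import all_boot all_order all_algebra.
From mathcomp Require Import reals.
Set Implicit Arguments.
Unset Strict Implicit.
Unset Printing Implicit Defensive.
Import Order.TTheory GRing.Theory Num.Theory.
Local Open Scope ring_scope.

(* [sigma2] is the noise power sigma^2 itself, not its square root. *)
Definition SNR_NCR (R : realType) (M : nat)
    (P sigma2 beta1 beta2 alphaNCR : R) : R :=
  (alphaNCR ^+ 2 * P * M%:R * beta1 * beta2)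
    / (sigma2 * (1 + alphaNCR ^+ 2 * beta2 * M%:R)).

Definition SNR_PRIS (R : realType) (M N : nat)
    (P sigma2 beta1 beta2 : R) : R :=
  (P * beta1 * beta2 * N%:R ^+ 2 * M%:R) / sigma2.

(* Main.v *)
Require Import Defs.
From HB Require Import structures.
From mathcomp Require Import all_boot all_order all_algebra.
From mathcomp Require Import reals.
From mathcomp Require Import ring.
Set Implicit Arguments.
Unset Strict Implicit.
Unset Printing Implicit Defensive.
Import Order.TTheory GRing.Theory Num.Theory.
Local Open Scope ring_scope.

(** Write c = 1 - N^2 M beta2. Over a common denominator, the difference of the two SNRs is a
    positive factor times alpha^2 c - N^2, so [SNR_PRIS_le_NCR] reduces the comparison to N^2 <=
    alpha^2 c. If c > 0, taking square roots of nonnegative quantities gives the threshold N / sqrt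
    c; if c <= 0, the right side is nonpositive while N^2 > 0, so the repeater never catches up. *)

Lemma SNR_PRIS_le_NCR (R : realType) (M N : nat)
    (P sigma2 beta1 beta2 alpha : R) :
  (0 < M)%N -> 0 < P -> 0 < sigma2 -> 0 < beta1 -> 0 < beta2 ->
  (SNR_PRIS M N P sigma2 beta1 beta2 <= SNR_NCR M P sigma2 beta1 beta2 alpha)
    = (N%:R ^+ 2 <= alpha ^+ 2 * (1 - N%:R ^+ 2 * M%:R * beta2)).
Proof.
move=> M_gt0 P_gt0 s_gt0 b1_gt0 b2_gt0.
have m_gt0 : 0 < M%:R :> R by rewrite ltr0n.
have D_gt0 : 0 < 1 + alpha ^+ 2 * beta2 * M%:R.
  by rewrite ltr_pwDl // mulr_ge0 ?(ltW m_gt0) // mulr_ge0 ?sqr_ge0 ?(ltW b2_gt0).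
rewrite -[LHS]subr_ge0 -[RHS]subr_ge0.
(* The term alpha^2 beta2 M in the repeater's denominator, its amplified noise, is what produces the
   -N^2 M beta2 inside the bracket. *)
have -> : SNR_NCR M P sigma2 beta1 beta2 alpha - SNR_PRIS M N P sigma2 beta1 beta2
    = P * beta1 * beta2 * M%:R / (sigma2 * (1 + alpha ^+ 2 * beta2 * M%:R))
      * (alpha ^+ 2 * (1 - N%:R ^+ 2 * M%:R * beta2) - N%:R ^+ 2).
  by rewrite /SNR_NCR /SNR_PRIS; field; rewrite !gt_eqF.
by rewrite pmulr_rge0 // divr_gt0 // !mulr_gt0.
Qed.

Theorem mainTheorem6 (R : realType) (M N : nat) (P sigma2 beta1 beta2 : R)
    (hM : (1 <= M)%N) (hN : (1 <= N)%N)
    (hP : 0 < P) (hsigma2 : 0 < sigma2)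
    (hbeta1 : 0 < beta1) (hbeta2 : 0 < beta2) :
  (0 < 1 - N%:R ^+ 2 * M%:R * beta2 ->
   forall alphaNCR : R, 0 <= alphaNCR ->
     (SNR_NCR M P sigma2 beta1 beta2 alphaNCR
        >= SNR_PRIS M N P sigma2 beta1 beta2
      <-> alphaNCR >= N%:R / Num.sqrt (1 - N%:R ^+ 2 * M%:R * beta2)))
  /\
  (N%:R ^+ 2 * M%:R * beta2 >= 1 ->
   forall alphaNCR : R, 0 <= alphaNCR ->
     SNR_PRIS M N P sigma2 beta1 beta2
       > SNR_NCR M P sigma2 beta1 beta2 alphaNCR).
Proof.
split=> [c_gt0 a a_ge0|c_ge1 a _].
  rewrite SNR_PRIS_le_NCR // ler_pdivrMr ?sqrtr_gt0 //.
  (* Writing c as (sqrt c)^2 makes both sides squares, of N and of a sqrt c. *)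
  rewrite -[X in a ^+ 2 * X]sqr_sqrtr ?(ltW c_gt0) // -exprMn.
  by rewrite ler_pXn2r // nnegrE ?ler0n // mulr_ge0 // sqrtr_ge0.
rewrite ltNge SNR_PRIS_le_NCR // -ltNge.
(* Separate the two sides by 0: a^2 c <= 0 < N^2, strict because N >= 1. *)
apply: (@le_lt_trans _ _ 0); last by rewrite exprn_gt0 // ltr0n.
by rewrite mulr_ge0_le0 ?sqr_ge0 // subr_le0.
Qed.
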